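(* Let $A\in\mathbb{R}^{n\times d}$ have rows $a_1^\top,\dots,a_n^\top$, let $f_1,\dots,f_n:\mathbb{R}\to\mathbb{R}$ be convex and each $(1/\gamma)$-smooth with $\gamma>0$, and let $g:\mathbb{R}^d\to\mathbb{R}\cup\{+\infty\}$ be closed and $\mu$-strongly convex with $\mu>0$. Consider the saddle-point problem $\min_x\max_y \tilde F(x,y)$ with $\tilde{F}(x,y)=\frac1n\langle y,Ax\rangle+g(x)-\frac1n\sum_{i=1}^n f_i^*(y_i)$, and let $(x^*,y^* )$ be its (unique) saddle point. Let $\bar R=\max_i\|a_i\|_2$. Run the SDAPD method (described in the context) with $$\eta=\frac{1}{\bar R}\sqrt{\frac{\gamma}{n\mu}},\quad \tau=\frac{1}{\bar R}\sqrt{\frac{n\mu}{\gamma}},\quad \beta_t=\frac{1}{\bar R}\sqrt{\frac{\gamma}{n\mu}}\,\xi^t,\quad \xi=1+\frac{1}{n+\bar R\sqrt{n/(\mu\gamma)}},$$ and for $T\ge1$ define $\hat{x}^T=\frac{1}{B_{T-1}}\sum_{t=0}^{T-1}\beta_t\bar{x}^{t+1}$. Then there is a constant $\Delta_0\ge0$, independent of $T$ and depending only on the problem data ($\bar R$, $n$, $\mu$, $\gamma$, $A$, $f_i$, $g$), the initial point $(x^0,y^0)$ and $(x^*,y^* )$, such that for all $T\ge 1$ $$\mathbb{E}\|\hat{x}^T-x^*\|_2^2\le\frac{\Delta_0}{\xi^T-1}.$$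
   Context: $f_i^*$ is the convex conjugate of $f_i$; $\operatorname{prox}_h(u)=\arg\min_v\{h(v)+\frac12\|v-u\|_2^2\}$. SDAPD method: given $x^0\in\mathbb{R}^d$, $y^0\in\mathbb{R}^n$, $\eta,\tau>0$ and $\beta_t>0$, set $B_t=\sum_{k=0}^t\beta_k$. For $t=0,1,\dots$: sample $i_t$ uniformly from $\{1,\dots,n\}$, independently of the past; compute $\bar{x}^{t+1}=\operatorname{prox}_{\eta g}(x^t-\frac{\eta}{n}A^\top y^t)$; set $y^{t+1}_{i}=\operatorname{prox}_{\tau f_i^*}(y_i^t+\tau\langle a_i,\bar{x}^{t+1}\rangle)$ if $i=i_t$ and $y^{t+1}_i=y^t_i$ otherwise; set $\bar{y}^{t+1}=y^t+n(y^{t+1}-y^t)$; set $x^{t+1}=\operatorname{prox}_{B_t g}(x^0-s^{t+1})$ with $s^{t+1}=\sum_{k=0}^t\frac{\beta_k}{n}A^\top\bar{y}^{k+1}$. The expectation is over the random indices $i_0,i_1,\dots$. *)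

(* Defs.v *)
From HB Require Import structures.
From mathcomp Require Import all_boot all_order all_algebra.
From mathcomp Require Import all_classical all_reals all_analysis.
Set Implicit Arguments. Unset Strict Implicit. Unset Printing Implicit Defensive.
Import Order.TTheory GRing.Theory Num.Theory.
Import numFieldNormedType.Exports.
Local Open Scope classical_set_scope.
Local Open Scope ring_scope.

Section Defs.
Variable R : realType.

Definition sqn (k : nat) (v : 'cV[R]_k) : R := \sum_(j < k) (v j 0) ^+ 2.

Definition row_norm (n d : nat) (A : 'M[R]_(n, d)) (i : 'I_n) : R :=
  Num.sqrt (\sum_(j < d) (A i j) ^+ 2).

Definition Rbar (n d : nat) (A : 'M[R]_(n, d)) : R :=
  \big[Num.max/0]_(i < n) row_norm A i.

Definition convex_fun (f : R -> R) : Prop :=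
  forall x y t : R, 0 <= t <= 1 ->
    f (t * x + (1 - t) * y) <= t * f x + (1 - t) * f y.

Definition smooth_fun (L : R) (f : R -> R) : Prop :=
  (forall x, derivable f x 1) /\
  forall x y, `| derive1 f x - derive1 f y | <= L * `| x - y |.

Definition conj_fun (f : R -> R) (y : R) : \bar R :=
  ereal_sup [set ((x * y - f x)%:E) | x in [set: R]].

Definition closed_fun (d : nat) (g : 'cV[R]_d -> \bar R) : Prop :=
  closed [set p : 'cV[R]_d * R | (g p.1 <= p.2%:E)%E].

Definition strongly_convex (d : nat) (mu : R) (g : 'cV[R]_d -> \bar R) : Prop :=
  forall x y : 'cV[R]_d, forall t : R, 0 <= t <= 1 ->
    (g (t *: x + (1 - t) *: y)%R <=
      t%:E * g x + (1 - t)%:E * g y - (mu / 2 * t * (1 - t) * sqn (x - y))%:E)%E.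

Definition prox_vec (d : nat) (c : R) (h : 'cV[R]_d -> \bar R) (u : 'cV[R]_d)
  : 'cV[R]_d :=
  xget u [set v | forall w,
    (c%:E * h v + (sqn (v - u) / 2)%:E <= c%:E * h w + (sqn (w - u) / 2)%:E)%E].

Definition prox_scal (c : R) (h : R -> \bar R) (u : R) : R :=
  xget u [set v | forall w,
    (c%:E * h v + ((v - u) ^+ 2 / 2)%:E <= c%:E * h w + ((w - u) ^+ 2 / 2)%:E)%E].

Definition Ftilde (n d : nat) (A : 'M[R]_(n, d)) (f : 'I_n -> R -> R)
  (g : 'cV[R]_d -> \bar R) (x : 'cV[R]_d) (y : 'cV[R]_n) : \bar R :=
  ((n%:R^-1 * \sum_(i < n) y i 0 * (A *m x) i 0)%R%:E + g x
    - (n%:R^-1)%:E * \sum_(i < n) conj_fun (f i) (y i 0%R))%E.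

Definition is_saddle_point (n d : nat) (A : 'M[R]_(n, d)) (f : 'I_n -> R -> R)
  (g : 'cV[R]_d -> \bar R) (xs : 'cV[R]_d) (ys : 'cV[R]_n) : Prop :=
  Ftilde A f g xs ys \is a fin_num /\
  (forall x y, (Ftilde A f g xs y <= Ftilde A f g xs ys <= Ftilde A f g x ys)%E).

Record sdapd_state (n d : nat) := SState {
  st_x : 'cV[R]_d; st_y : 'cV[R]_n; st_s : 'cV[R]_d; st_xbar : 'cV[R]_d }.

Definition Bsum (beta : nat -> R) (t : nat) : R := \sum_(k < t.+1) beta k.

Definition sdapd_step (n d : nat) (A : 'M[R]_(n, d)) (f : 'I_n -> R -> R)
  (g : 'cV[R]_d -> \bar R) (eta tau : R) (beta : nat -> R) (x0 : 'cV[R]_d)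
  (t : nat) (i : nat) (st : sdapd_state n d) : sdapd_state n d :=
  let xt := st_x st in let yt := st_y st in
  let xbar := prox_vec eta g (xt - (eta / n%:R) *: (A^T *m yt)) in
  let y' := \col_(j < n) (if (j : nat) == i then
              prox_scal tau (conj_fun (f j)) (yt j 0 + tau * (A *m xbar) j 0)
            else yt j 0) in
  let ybar := yt + n%:R *: (y' - yt) in
  let s' := st_s st + (beta t / n%:R) *: (A^T *m ybar) in
  let x' := prox_vec (Bsum beta t) g (x0 - s') in
  SState x' y' s' xbar.

Fixpoint sdapd (n d : nat) (A : 'M[R]_(n, d)) (f : 'I_n -> R -> R)
  (g : 'cV[R]_d -> \bar R) (eta tau : R) (beta : nat -> R) (x0 : 'cV[R]_d)
  (y0 : 'cV[R]_n) (idx : nat -> nat) (t : nat) : sdapd_state n d :=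
  match t with
  | 0 => SState x0 y0 0 x0
  | t'.+1 => sdapd_step A f g eta tau beta x0 t' (idx t')
               (sdapd A f g eta tau beta x0 y0 idx t')
  end.

(* xbar^{t} for t >= 1 *)
Definition sdapd_xbar n d A f g eta tau beta x0 y0 idx t :=
  st_xbar (@sdapd n d A f g eta tau beta x0 y0 idx t).

Definition sdapd_xhat n d A f g eta tau beta x0 y0 idx (T : nat) : 'cV[R]_d :=
  (Bsum beta T.-1)^-1 *:
    \sum_(t < T) beta t *: @sdapd_xbar n d A f g eta tau beta x0 y0 idx t.+1.

(* index sequence from a finite sample w : 'I_T -> 'I_n (i_t = w t for t < T) *)
Definition idx_of (T n : nat) (w : {ffun 'I_T -> 'I_n}) (t : nat) : nat :=
  odflt 0%N (omap (fun k : 'I_T => nat_of_ord (w k)) (insub t)).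

(* expectation over i_0..i_{T-1} i.i.d. uniform on {0..n-1} *)
Definition expect_idx (T n : nat) (X : (nat -> nat) -> R) : R :=
  (n%:R ^+ T)^-1 * \sum_(w : {ffun 'I_T -> 'I_n}) X (idx_of w).

End Defs.

(* Main.v *)
(** With [B_t] the sum of [beta_k] over [k < t], dual averaging keeps the invariant
      [L_t + (1 + mu B_t)/2 |x - x^t|^2
         <= B_t (g x - g xs) + <s^t, x - xs> + |x - x0|^2 / 2],
    where [L_t] accumulates
      [beta_k (g xbar - g xs + <A^T ybar, xbar - xs> / n - |y^{k+1} - y^k|^2 / (2 tau))].
    The extrapolated point [xbar] pays for the unknown slope because
    [eta tau Rbar^2 = 1] and [beta_t <= eta (1 + mu B_t)]; at [x = xs] this bounds
    [L_T] by [|xs - x0|^2 / 2] along every path.  On the dual side, each [f_i'] is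
    [gamma]-cocoercive and [ybar] is unbiased, so averaging over the sampled
    coordinate yields a supermartingale combining [L_t], [beta_t |y^t - ys|^2] and
    the weighted sum of [mu/2 |xbar - xs|^2].  Jensen's inequality and
    [B_T = eta (xi^T - 1) / (xi - 1)] finish the argument. *)
Require Import Defs.
From HB Require Import structures.
From mathcomp Require Import all_boot all_order all_algebra.
From mathcomp Require Import all_classical all_reals all_analysis.
From mathcomp Require Import ring lra.
Import Order.TTheory GRing.Theory Num.Theory.
Import numFieldNormedType.Exports.
Local Open Scope ring_scope.
Set Implicit Arguments.
Unset Strict Implicit.
Unset Printing Implicit Defensive.

(** * Conjugates of smooth convex functions on the line *)

Section SmoothConvexConjugate.
Variable R : realType.
Implicit Types (f : R -> R) (L gamma tau x y z u v w : R).

(** Lets a convexity parameter [t] tend to 0 once an inequality has been divided by [t]. *)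
Lemma ler_addgt0Ml (a b c : R) :
  (forall t, 0 < t < 1 -> a <= b + t * c) -> a <= b.
Proof.
move=> H; apply/ler_addgt0Pr => e e0.
pose t := Num.min 2^-1 (e / (`|c| + 1)).
have c1 : 0 < `|c| + 1 by rewrite ltr_wpDl.
have t0 : 0 < t by rewrite lt_min invr_gt0 ltr0n/= divr_gt0.
have t1 : t < 1 by rewrite gt_min; apply/orP; left; lra.
have te : t * (`|c| + 1) <= e by rewrite -ler_pdivlMr// ge_min lexx orbT.
have := H t; rewrite t0 t1 => /(_ isT) /le_trans; apply.
rewrite lerD2l; apply: le_trans te; rewrite ler_pM2l//.
by rewrite (le_trans (ler_norm c))// lerDl.
Qed.

(** Descent lemma: [h], up to a constant [f] minus its quadratic model, has derivative nonnegative
    left of [z] and nonpositive right of it, so it is largest at [z]. *)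
Lemma smooth_fun_le f L z u : smooth_fun L f ->
  f u <= f z + derive1 f z * (u - z) + L / 2 * (u - z) ^+ 2.
Proof.
move=> [df lf].
pose h s := f s - derive1 f z * s - L / 2 * (s - z) ^+ 2.
pose dh s := derive1 f s - derive1 f z - L * (s - z).
have dhE s : is_derive s (1:R) h (dh s).
  have dfs : is_derive s (1:R) f (derive1 f s).
    by rewrite derive1E; exact/derivableP.
  by rewrite /h; apply: is_derive_eq; rewrite /dh /GRing.scale/=; field.
have ch a b : {within `[a, b], continuous h}%classic.
  apply: derivable_within_continuous => s _; exact: ex_derive.
have huz : h u <= h z.
  have [zu|uz] := leP z u.
    have [c] := MVT_segment zu (fun s _ => dhE s) (ch _ _).
    rewrite in_itv/= => /andP[zc cu] E.
    have := lf c z; rewrite (ger0_norm (x := c - z)) ?subr_ge0// => lfc.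
    have dc : dh c <= 0 by rewrite subr_le0 (le_trans (ler_norm _)).
    by rewrite -subr_le0 E; apply: mulr_le0_ge0 => //; rewrite subr_ge0.
  have [c] := MVT_segment (ltW uz) (fun s _ => dhE s) (ch _ _).
  rewrite in_itv/= => /andP[uc cz] E.
  have := lf c z; rewrite distrC (ler0_norm (x := c - z)) ?subr_le0// => lfc.
  have dc : 0 <= dh c.
    by rewrite /dh; have := le_trans (ler_norm _) lfc; lra.
  by rewrite -subr_ge0 E; apply: mulr_ge0 => //; rewrite subr_ge0 ltW.
move: huz; rewrite /h subrr expr0n/= mulr0 subr0; lra.
Qed.

Lemma smooth_funN f L : smooth_fun L f -> smooth_fun L (fun x => - f x).
Proof.
move=> [df lf]; have dN x : derive1 (fun x => - f x) x = - derive1 f x.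
  by rewrite !derive1E deriveN.
split=> [x|x y]; first exact: derivableN.
by rewrite !dN -opprD normrN.
Qed.

Lemma smooth_fun_ge f L z u : smooth_fun L f ->
  f z + derive1 f z * (u - z) - L / 2 * (u - z) ^+ 2 <= f u.
Proof.
move=> sf; have := smooth_fun_le z u (smooth_funN sf).
have -> : derive1 (fun x => - f x) z = - derive1 f z.
  by case: sf => df _; rewrite !derive1E deriveN.
lra.
Qed.

Section OneFunction.
Variables (f : R -> R) (gamma : R).
Hypotheses (gamma_gt0 : 0 < gamma) (cf : convex_fun f).
Hypothesis sf : smooth_fun gamma^-1 f.

(** Convexity on the segment from [y] to [x] meets the quadratic lower bound at [y]; dividing by [t]
    and letting [t] tend to 0 removes the quadratic term. *)
Lemma convex_smooth_ge_tangent x y : f y + derive1 f y * (x - y) <= f x.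
Proof.
apply: (@ler_addgt0Ml _ _ (gamma^-1 / 2 * (x - y) ^+ 2)) => t /andP[t0 t1].
have := smooth_fun_ge y (t * x + (1 - t) * y) sf.
have tx : t * x + (1 - t) * y - y = t * (x - y) by ring.
have := @cf x y t; rewrite (ltW t0) (ltW t1) => /(_ isT).
rewrite tx => h1 h2; rewrite -(ler_pM2l t0).
move: (le_trans h2 h1); rewrite exprMn; lra.
Qed.

(* Baillon-Haddad: test the tangent at [c] and the quadratic upper bound at [z]
   against the point [z + gamma (f' c - f' z)], then symmetrise. *)
Lemma derive1_cocoercive z c :
  gamma * (derive1 f z - derive1 f c) ^+ 2 <=
  (z - c) * (derive1 f z - derive1 f c).
Proof.
have half a b : derive1 f b * (a - b) +
    gamma / 2 * (derive1 f a - derive1 f b) ^+ 2 <= f a - f b.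
  set v := derive1 f a; set w := derive1 f b.
  have h1 := convex_smooth_ge_tangent (a + gamma * (w - v)) b.
  have h2 := smooth_fun_le a (a + gamma * (w - v)) sf.
  have h := le_trans h1 h2; move: h; rewrite -/v -/w.
  have -> : gamma^-1 / 2 * (a + gamma * (w - v) - a) ^+ 2 =
      gamma / 2 * (w - v) ^+ 2 by field; rewrite gt_eqF.
  lra.
have := lerD (half z c) (half c z); lra.
Qed.

Lemma derive1_convex_smooth_homo z c : z <= c -> derive1 f z <= derive1 f c.
Proof.
move=> zc; have := derive1_cocoercive z c.
rewrite leNgt => H; rewrite leNgt; apply: contra H => H.
apply: (@le_lt_trans _ _ 0); first by rewrite mulr_le0_ge0 ?subr_le0 ?subr_ge0// ltW.
by rewrite mulr_gt0// exprn_gt0// subr_gt0.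
Qed.

Lemma conj_fun_ge w z : ((w * z - f z)%:E <= conj_fun f w)%E.
Proof. by apply: ereal_sup_ubound; exists z => //; rewrite mulrC. Qed.

(** Equality case of Fenchel-Young: the tangent inequality at [z] bounds the supremum, which is
    attained there. *)
Lemma conj_fun_derive1 z :
  conj_fun f (derive1 f z) = (derive1 f z * z - f z)%:E.
Proof.
apply/le_anti/andP; split; last exact: conj_fun_ge.
apply: ge_ereal_sup => _ [x _ <-]; rewrite lee_fin.
have := convex_smooth_ge_tangent x z; lra.
Qed.

Lemma resolvent_derive1 tau u : 0 < tau ->
  exists z, tau * z + derive1 f z = u.
Proof.
move=> tau0; pose h z := tau * z + derive1 f z.
have ch : continuous h.
  have cdf : continuous (derive1 f).
    move=> z; apply/cvgrPdist_le => e e0; near=> y.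
    have [_ lf] := sf; apply: le_trans (lf _ _) _.
    rewrite mulrC ler_pdivrMr//; near: y.
    by apply: cvgr_dist_le; [exact: cvg_id|rewrite mulr_gt0].
  by move=> z; apply: cvgD; [apply: cvgM; [exact: cvg_cst|exact: cvg_id]|exact: cdf].
(* Chosen so that [h z1 = u + (f' z1 - f' 0)]; as [f'] is monotone, [u] lies between [h 0] and
   [h z1] whatever the sign of [z1]. *)
pose z1 := (u - derive1 f 0) / tau.
have tz1 : tau * z1 = u - derive1 f 0 by rewrite mulrC divfK// gt_eqF.
have h0 : h 0 = derive1 f 0 by rewrite /h mulr0 add0r.
have h1 : h z1 = u + (derive1 f z1 - derive1 f 0) by rewrite /h tz1; ring.
have [z0|z0] := leP 0 z1.
  have d01 := derive1_convex_smooth_homo z0.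
  have t0 : 0 <= tau * z1 by rewrite mulr_ge0// ltW.
  case: (@IVT _ h 0 z1 u z0 (continuous_subspaceT ch)) => [|z _ <-]; last by exists z.
  rewrite h0 h1 ge_min le_max; apply/andP; split; apply/orP; [left|right]; lra.
have d01 := derive1_convex_smooth_homo (ltW z0).
have t0 : tau * z1 <= 0 by rewrite mulr_ge0_le0// ltW.
case: (@IVT _ h z1 0 u (ltW z0) (continuous_subspaceT ch)) => [|z _ <-]; last by exists z.
rewrite h0 h1 ge_min le_max; apply/andP; split; apply/orP; [left|right]; lra.
Unshelve. all: by end_near. Qed.

(* Moreau: the proximal point of the conjugate is a value of [f']. *)
Lemma prox_scal_conj_fun tau u : 0 < tau ->
  exists2 z, prox_scal tau (conj_fun f) u = derive1 f z &
    tau * z = u - derive1 f z.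
Proof.
move=> tau0; have [z zE] := resolvent_derive1 u tau0.
exists z; last by rewrite -zE addrK.
set v := derive1 f z in zE *.
have vmin w : (tau%:E * conj_fun f v + ((v - u) ^+ 2 / 2)%:E <=
    tau%:E * conj_fun f w + ((w - u) ^+ 2 / 2)%:E)%E.
  apply: (@le_trans _ _ (tau%:E * (w * z - f z)%:E + ((w - u) ^+ 2 / 2)%:E)%E).
    rewrite /v conj_fun_derive1 -/v -!EFinM -!EFinD lee_fin -zE.
    have := sqr_ge0 (w - v); nra.
  by rewrite leeD2r// lee_pmul2l ?lte_fin// ?fin_num_fun//; exact: conj_fun_ge.
(* A minimiser exists, so [xget] does not fall back on its default. Fenchel-Young at [z], an
   equality for [v], forces the chosen [p] to be [v]. *)
rewrite /prox_scal; case: xgetP => [p _ pmin|/(_ v)]; last by case.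
have pv := pmin v.
have : (tau%:E * (p * z - f z)%:E + ((p - u) ^+ 2 / 2)%:E <=
    tau%:E * conj_fun f v + ((v - u) ^+ 2 / 2)%:E)%E.
  apply: le_trans pv; rewrite leeD2r// lee_pmul2l ?lte_fin//; exact: conj_fun_ge.
rewrite /v conj_fun_derive1 -/v -!EFinM -!EFinD lee_fin -zE => H.
have : (p - v) ^+ 2 <= 0 by nra.
rewrite le_eqVlt ltNge sqr_ge0 orbF sqrf_eq0 subr_eq0 => /eqP.
exact.
Qed.

Lemma conj_fun_max_derive1 c y (r : R) : conj_fun f y = r%:E ->
  (forall w s, conj_fun f w = s%:E -> w * c - s <= y * c - r) ->
  y = derive1 f c.
Proof.
move=> yr /(_ _ _ (conj_fun_derive1 c)) ymax; set w := derive1 f c in ymax *.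
(* The minimiser of the quadratic upper bound of [f] around [c] minus the line of slope [y]. *)
pose z := c - gamma * (w - y).
have := conj_fun_ge y z; rewrite yr lee_fin => yz.
have := smooth_fun_le c z sf; rewrite -/w.
have -> : gamma^-1 / 2 * (z - c) ^+ 2 = gamma / 2 * (w - y) ^+ 2.
  by rewrite /z; field; rewrite gt_eqF.
move=> H; have : gamma / 2 * (w - y) ^+ 2 <= 0 by rewrite /z in H yz *; nra.
rewrite pmulr_rle0 ?divr_gt0// le_eqVlt ltNge sqr_ge0 orbF sqrf_eq0 subr_eq0.
by move=> /eqP.
Qed.

End OneFunction.

(* One proximal step of the dual coordinate [y] towards the slope [cbar],
   compared with the optimal value [f' c]. *)
Lemma prox_scal_conj_fun_ineq f gamma tau c cbar y p : 0 < gamma -> 0 < tau ->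
  convex_fun f -> smooth_fun gamma^-1 f ->
  p = prox_scal tau (conj_fun f) (y + tau * cbar) ->
  (gamma + (2 * tau)^-1) * (p - derive1 f c) ^+ 2 +
  (2 * tau)^-1 * ((p - y) ^+ 2 - (y - derive1 f c) ^+ 2)
    <= (cbar - c) * (p - derive1 f c).
Proof.
move=> gamma0 tau0 cf sf pE.
have [z] := prox_scal_conj_fun gamma0 cf sf (y + tau * cbar) tau0.
rewrite -pE => pz zE.
have := derive1_cocoercive gamma0 cf sf z c; rewrite -pz.
set w := derive1 f c => H.
have cE : cbar = z + (p - y) / tau.
  apply: (mulfI (lt0r_neq0 tau0)); rewrite mulrDr (mulrC tau (_ / _)) divfK ?gt_eqF// zE -pz; ring.
(* Three-point identity for [(p - y) * (p - w)], after substituting the optimality condition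
   [cE]. *)
have -> : (cbar - c) * (p - w) = (z - c) * (p - w) +
    (2 * tau)^-1 * ((p - y) ^+ 2 + (p - w) ^+ 2 - (y - w) ^+ 2).
  by rewrite cE; field; rewrite gt_eqF.
lra.
Qed.

End SmoothConvexConjugate.

(** * Inner product and squared norm of column vectors *)

Section EuclideanVectors.
Variables (R : realType) (d : nat).
Implicit Types (u v w x y : 'cV[R]_d) (c : R).

Definition dot u v : R := \sum_(j < d) u j 0 * v j 0.

Lemma dotC u v : dot u v = dot v u.
Proof. by apply: eq_bigr => j _; rewrite mulrC. Qed.

Lemma dotDl u v w : dot (u + v) w = dot u w + dot v w.
Proof. by rewrite -big_split; apply: eq_bigr => j _; rewrite mxE mulrDl. Qed.

Lemma dotDr u v w : dot w (u + v) = dot w u + dot w v.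
Proof. by rewrite dotC dotDl !(dotC w). Qed.

Lemma dotZl c u v : dot (c *: u) v = c * dot u v.
Proof. by rewrite mulr_sumr; apply: eq_bigr => j _; rewrite mxE mulrA. Qed.

Lemma dotZr c u v : dot u (c *: v) = c * dot u v.
Proof. by rewrite dotC dotZl dotC. Qed.

Lemma dot0r u : dot u 0 = 0.
Proof. by rewrite -(scale0r u) dotZr mul0r. Qed.

Lemma dotNl u v : dot (- u) v = - dot u v.
Proof. by rewrite -scaleN1r dotZl mulN1r. Qed.

Lemma dotNr u v : dot u (- v) = - dot u v.
Proof. by rewrite dotC dotNl dotC. Qed.

Lemma dot0l u : dot 0 u = 0.
Proof. by rewrite dotC dot0r. Qed.

Definition dotE := (dotDl, dotDr, dotZl, dotZr, dotNl, dotNr).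

Lemma dot_suml (I : Type) (r : seq I) (F : I -> 'cV[R]_d) v :
  dot (\sum_(i <- r) F i) v = \sum_(i <- r) dot (F i) v.
Proof.
elim: r => [|a r IH]; first by rewrite !big_nil dot0l.
by rewrite !big_cons dotDl IH.
Qed.

Lemma sqnE v : sqn v = dot v v.
Proof. by apply: eq_bigr => j _; rewrite expr2. Qed.

Lemma sqn_ge0 v : 0 <= sqn v.
Proof. by apply: sumr_ge0 => j _; exact: sqr_ge0. Qed.

Lemma sqnD u v : sqn (u + v) = sqn u + 2 * dot u v + sqn v.
Proof. by rewrite !sqnE !dotE (dotC v u); ring. Qed.

Lemma sqnB u v : sqn (u - v) = sqn u - 2 * dot u v + sqn v.
Proof. by rewrite !sqnE !dotE (dotC v u); ring. Qed.

Lemma sqn_coord v j : v j 0 ^+ 2 <= sqn v.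
Proof.
rewrite /sqn (bigD1 j)//= lerDl; apply: sumr_ge0 => i _; exact: sqr_ge0.
Qed.

Lemma dot_sqr_le u v : dot u v ^+ 2 <= sqn u * sqn v.
Proof.
have [v0|v0] := eqVneq (sqn v) 0.
  have vj j : v j 0 = 0.
    by apply/eqP; rewrite -sqrf_eq0 eq_le sqr_ge0 -v0 sqn_coord.
  rewrite v0 mulr0 /dot big1 ?expr0n// => j _; by rewrite vj mulr0.
have {}v0 : 0 < sqn v by rewrite lt_def v0 sqn_ge0.
have := sqn_ge0 (sqn v *: u - dot u v *: v).
rewrite sqnB !sqnE !dotE -!sqnE => H.
rewrite -(ler_pM2l v0) -subr_ge0; apply: le_trans H _; lra.
Qed.

Lemma sqn_convex u v c :
  sqn (c *: u + (1 - c) *: v) = c * sqn u + (1 - c) * sqn v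
    - c * (1 - c) * sqn (u - v).
Proof. by rewrite !sqnE !dotE (dotC v u); ring. Qed.

(* Jensen, from the nonnegativity of the weighted variance. *)
Lemma sqn_wmean (T : nat) (b : nat -> R) (v : nat -> 'cV[R]_d) x :
  (forall t, 0 <= b t) -> 0 < \sum_(t < T) b t ->
  sqn ((\sum_(t < T) b t)^-1 *: (\sum_(t < T) b t *: v t) - x) <=
  (\sum_(t < T) b t)^-1 * \sum_(t < T) b t * sqn (v t - x).
Proof.
move=> b0; set B := \sum_(t < T) b t => B0.
set m := _ - x; rewrite mulrC ler_pdivlMr//.
have mE : B *: m = \sum_(t < T) b t *: (v t - x).
  rewrite /m scalerBr scalerA divff ?gt_eqF// scale1r scaler_suml -sumrB.
  by apply: eq_bigr => t _; rewrite scalerBr.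
have : \sum_(t < T) b t * (2 * dot (v t - x) m - sqn m) <=
    \sum_(t < T) b t * sqn (v t - x).
  apply: ler_sum => t _; rewrite ler_wpM2l//.
  have := sqn_ge0 (v t - x - m); rewrite sqnB; lra.
have -> : \sum_(t < T) b t * (2 * dot (v t - x) m - sqn m) = sqn m * B.
  transitivity (2 * dot (B *: m) m - B * sqn m); last first.
    by rewrite dotZl -sqnE; ring.
  rewrite mE dot_suml mulr_sumr mulr_suml -sumrB; apply: eq_bigr => t _.
  by rewrite dotZl; ring.
by [].
Qed.

Lemma sqn_continuous : continuous (@sqn R d).
Proof.
rewrite /sqn; apply: continuous_big => [|j _]; first exact: add_continuous.
under eq_fun do rewrite expr2.
by move=> v; have cj := @coord_continuous R d 1 j 0 v; exact: (cvgM cj cj).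
Qed.

End EuclideanVectors.

Lemma dot_trmx (R : realType) (m k : nat) (A : 'M[R]_(m, k)) y x :
  dot (A^T *m y) x = dot y (A *m x).
Proof.
rewrite /dot; under eq_bigr do rewrite mxE big_distrl/=.
rewrite exchange_big/=; apply: eq_bigr => i _.
by rewrite mxE mulr_sumr; apply: eq_bigr => j _; rewrite mxE mulrCA mulrA.
Qed.

(** * Proximal points of closed strongly convex functions *)

Section StronglyConvexProx.
Variables (R : realType) (d : nat) (g : 'cV[R]_d -> \bar R) (mu : R).
Hypotheses (mu_ge0 : 0 <= mu) (g_NNy : forall x, g x != -oo%E).
Hypotheses (clg : closed_fun g) (scg : strongly_convex mu g).
Local Notation dom := (fun x => g x \is a fin_num).
Local Notation G := (fun x => fine (g x)).
Implicit Types (c r t : R) (u v w x y p : 'cV[R]_d).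

Lemma notin_dom x : ~~ dom x -> g x = +oo%E.
Proof. by have := g_NNy x; case: (g x). Qed.

Lemma strongly_convex_dom x y t : dom x -> dom y -> 0 <= t <= 1 ->
  dom (t *: x + (1 - t) *: y) /\
  G (t *: x + (1 - t) *: y) <=
    t * G x + (1 - t) * G y - mu / 2 * t * (1 - t) * sqn (x - y).
Proof.
move=> dx dy t01; have := scg x y t01.
rewrite -(fineK dx) -(fineK dy) -!EFinM -EFinN -!EFinD => H.
have dz : dom (t *: x + (1 - t) *: y).
  by rewrite fin_numE g_NNy /=; apply: contraTneq H => ->; rewrite leye_eq.
by split => //; rewrite -lee_fin (fineK dz).
Qed.

(** Quadratic growth at a minimiser: compare [x] with [t w + (1 - t) x] and let [t] tend to 0; the
    linear tilt leaves the modulus unchanged. *)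
Lemma strongly_convex_affine_minimizer x p : dom x ->
  (forall w, dom w -> G x + dot p x <= G w + dot p w) ->
  forall w, dom w -> G x + dot p x + mu / 2 * sqn (w - x) <= G w + dot p w.
Proof.
move=> dx xmin w dw.
apply: (@ler_addgt0Ml _ _ _ (mu / 2 * sqn (w - x))) => t /andP[t0 t1].
have /(strongly_convex_dom dw dx)[dz Gz] : 0 <= t <= 1 by rewrite !ltW.
have := le_trans (xmin _ dz) (lerD Gz (lexx _)); rewrite !dotE => H.
rewrite -(ler_pM2l t0); lra.
Qed.

(** Since [fine] sends infinite values to 0, this matches the objective of [prox_vec] only on the
    domain of [g]. *)
Definition prox_obj c u v := c * G v + sqn (v - u) / 2.

Lemma prox_obj_convex c u x y t : 0 <= c -> dom x -> dom y -> 0 <= t <= 1 ->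
  prox_obj c u (t *: x + (1 - t) *: y) <=
  t * prox_obj c u x + (1 - t) * prox_obj c u y
    - (1 + c * mu) / 2 * t * (1 - t) * sqn (x - y).
Proof.
move=> c0 dx dy t01; have [_ Gz] := strongly_convex_dom dx dy t01.
have -> : prox_obj c u (t *: x + (1 - t) *: y) =
  c * G (t *: x + (1 - t) *: y) + sqn (t *: (x - u) + (1 - t) *: (y - u)) / 2.
  rewrite /prox_obj; congr (_ + sqn _ / 2).
  by apply/matrixP => i j; rewrite !mxE; ring.
rewrite sqn_convex opprB addrA subrK /prox_obj.
have := ler_wpM2l c0 Gz; lra.
Qed.

Lemma prox_obj_minimizer c u v : 0 <= c -> dom v ->
  (forall w, dom w -> prox_obj c u v <= prox_obj c u w) ->
  forall w, dom w ->
    prox_obj c u v + (1 + c * mu) / 2 * sqn (w - v) <= prox_obj c u w.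
Proof.
move=> c0 dv vmin w dw.
apply: (@ler_addgt0Ml _ _ _ ((1 + c * mu) / 2 * sqn (w - v))) => t /andP[t0 t1].
have t01 : 0 <= t <= 1 by rewrite !ltW.
have [dz _] := strongly_convex_dom dw dv t01.
have := le_trans (vmin _ dz) (prox_obj_convex u c0 dw dv t01).
move=> H; rewrite -(ler_pM2l t0); lra.
Qed.

(* A minimising sequence is Cauchy by strong convexity; its limit is a
   minimiser because the epigraph is closed. *)
Lemma prox_obj_has_minimizer c u x0 a p : 0 < c -> dom x0 ->
  (forall w, dom w -> a + dot p w <= G w) ->
  exists2 v, dom v & forall w, dom w -> prox_obj c u v <= prox_obj c u w.
Proof.
move=> c0 dx0 gp.
pose S := [set prox_obj c u w | w in [set w | dom w]]%classic.
(* The bound is the minimum of the affine minorant times [c] plus the squared distance, found by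
   completing the square. *)
have lbS : has_lbound S.
  exists (c * a + c * dot p u - c ^+ 2 * sqn p / 2) => _ [w dw <-].
  rewrite /prox_obj; have := ler_wpM2l (ltW c0) (gp _ dw).
  have := sqn_ge0 (w - u + c *: p).
  by rewrite !sqnE !dotE (dotC w p) (dotC u p); lra.
have infS : has_inf S by split=> //; exists (prox_obj c u x0), x0.
set m := inf S.
have m_le w : dom w -> m <= prox_obj c u w by move=> dw; apply: ge_inf => //; exists w.
have /choice[s sP] (k : nat) : exists w, dom w /\ prox_obj c u w <= m + harmonic k.
  have [_ [w dw <-] wk] := inf_adherent (harmonic_gt0 k) infS.
  by exists w; split => //; exact: ltW.
(* The midpoint of two almost minimisers cannot fall below [m], so the strong convexity term bounds
   their distance; its [c * mu] part is dropped. *)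
have s_near k l : sqn (s k - s l) <= 4 * (harmonic k + harmonic l).
  have [dk sk] := sP k; have [dl sl] := sP l.
  have h01 : 0 <= (2^-1 : R) <= 1 by rewrite invr_ge0 ler0n invf_le1 ?ltr0n// ler1n.
  have [dz _] := strongly_convex_dom dk dl h01.
  have := le_trans (m_le _ dz) (prox_obj_convex u (ltW c0) dk dl h01).
  have := mulr_ge0 (mulr_ge0 (ltW c0) mu_ge0) (sqn_ge0 (s k - s l)); lra.
have /cauchy_cvg/cvg_ex[v sv] : cauchy (s @ \oo)%classic.
  apply: cauchy_exP => e e0.
  have e8 : 0 < e ^+ 2 / 8 by rewrite divr_gt0 ?exprn_gt0.
  have [N _ NP] := cvgr_lt _ (@cvg_harmonic R) _ e8.
  exists (s N); exists N => // k /= Nk; split=> // i j; rewrite (ord1 j) /ball/=.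
  rewrite -(ltr_pXn2r (n := 2)) ?nnegrE ?normr_ge0 ?ltW// real_normK ?num_real//.
  have := sqn_coord (s N - s k) i; rewrite !mxE => /le_lt_trans; apply.
  apply: le_lt_trans (s_near _ _) _.
  have hN : harmonic N < e ^+ 2 / 8 := NP N (leqnn N).
  have hk : harmonic k < e ^+ 2 / 8 := NP k Nk.
  lra.
have hS : forall k, (g (s k) <= ((m + harmonic k - sqn (s k - u) / 2) / c)%:E)%E.
  move=> k; have [dk] := sP k; rewrite -(fineK dk) lee_fin ler_pdivlMr// /prox_obj; lra.
have : (g v <= ((m - sqn (v - u) / 2) / c)%:E)%E.
  pose F k := (s k, (m + harmonic k - sqn (s k - u) / 2) / c).
  suff Fv : (F @ \oo --> (v, (m - sqn (v - u) / 2) / c))%classic.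
    by apply: (closed_cvg _ clg _ _ Fv); apply: nearW => k; exact: hS.
  have qv : (sqn (s k - u) @[k --> \oo] --> sqn (v - u))%classic.
    have suv : (s k - u @[k --> \oo] --> v - u)%classic.
      by apply: cvgB => //; exact: cvg_cst.
    exact: (cvg_comp _ _ suv (@sqn_continuous R d (v - u))).
  have rv : ((m + harmonic k - sqn (s k - u) / 2) / c @[k --> \oo] -->
      (m - sqn (v - u) / 2) / c)%classic.
    have mh : (m + harmonic k @[k --> \oo] --> m)%classic.
      rewrite -[X in (_ --> X)%classic]addr0.
      by apply: cvgD; [exact: cvg_cst|exact: cvg_harmonic].
    exact: (cvgM (cvgB mh (cvgM qv (cvg_cst _))) (cvg_cst _)).
  exact: (cvg_pair sv rv).
move=> gv; have dv : dom v.
  by rewrite fin_numE g_NNy /=; apply: contraTneq gv => ->; rewrite leye_eq.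
exists v => // w dw; apply: le_trans (m_le _ dw).
by move: gv; rewrite -(fineK dv) lee_fin ler_pdivlMr// /prox_obj; lra.
Qed.

(** Existence excludes the default value of [xget], and comparison with a point of the domain makes
    the chosen minimiser finite. *)
Lemma prox_vecP c u x0 a p : 0 < c -> dom x0 ->
  (forall w, dom w -> a + dot p w <= G w) ->
  let v := prox_vec c g u in
  dom v /\ forall w, dom w ->
    prox_obj c u v + (1 + c * mu) / 2 * sqn (w - v) <= prox_obj c u w.
Proof.
move=> c0 dx0 gp; have [v dv vmin] := prox_obj_has_minimizer u c0 dx0 gp.
have objE w : dom w ->
    (c%:E * g w + (sqn (w - u) / 2)%:E)%E = (prox_obj c u w)%:E.
  by move=> dw; rewrite -(fineK dw) -EFinM -EFinD.
have objy w : ~~ dom w -> (c%:E * g w + (sqn (w - u) / 2)%:E)%E = +oo%E.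
  by move=> /notin_dom ->; rewrite gt0_muley ?lte_fin.
rewrite /prox_vec; case: xgetP => [q _ qmin|/(_ v)]; last first.
  case=> w; rewrite (objE v)//; case: (boolP (dom w)) => [dw|/objy->].
    by rewrite objE// lee_fin vmin.
  by rewrite leey.
have dq : dom q.
  apply: contraT => /objy qy; have := qmin v.
  by rewrite qy (objE v)// leye_eq.
split=> // w dw; apply: prox_obj_minimizer => //; first exact: ltW.
by move=> {}w {}dw; have := qmin w; rewrite !objE.
Qed.

End StronglyConvexProx.

(** * Optimality conditions at the saddle point *)

Section SaddlePoint.
Variables (R : realType) (n d : nat) (A : 'M[R]_(n, d)).
Variables (f : 'I_n -> R -> R) (g : 'cV[R]_d -> \bar R).
Variables (xs : 'cV[R]_d) (ys : 'cV[R]_n).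
Hypothesis n_gt0 : (0 < n)%N.
Hypothesis saddle : is_saddle_point A f g xs ys.

Let n1_gt0 : 0 < n%:R^-1 :> R. Proof. by rewrite invr_gt0 ltr0n. Qed.

Lemma Ftilde_fin (x : 'cV[R]_d) (y : 'cV[R]_n) : g x \is a fin_num ->
  (forall i, conj_fun (f i) (y i 0) \is a fin_num) ->
  Ftilde A f g x y = (n%:R^-1 * dot y (A *m x) + fine (g x) -
    n%:R^-1 * \sum_i fine (conj_fun (f i) (y i 0)))%:E.
Proof.
move=> gx cy; rewrite /Ftilde -(fineK gx).
by rewrite -(EFin_sum_fine _ (fun i _ => cy i)) -EFinM -EFinN -!EFinD.
Qed.

Lemma saddle_fin :
  g xs \is a fin_num /\ forall i, conj_fun (f i) (ys i 0) \is a fin_num.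
Proof.
have [] := saddle; rewrite /Ftilde fin_numB fin_numD => /andP[/andP[_ gx] cf] _.
split=> // i.
suff /sum_fin_numP : \sum_(i < n) conj_fun (f i) (ys i 0) \is a fin_num.
  by apply; rewrite ?mem_index_enum.
rewrite fin_numE; apply/andP; split; apply: contraTneq cf => ->.
  by rewrite gt0_muleNy ?lte_fin.
by rewrite gt0_muley ?lte_fin.
Qed.

Lemma saddle_primal w : g w \is a fin_num ->
  fine (g xs) + dot (n%:R^-1 *: (A^T *m ys)) xs <=
  fine (g w) + dot (n%:R^-1 *: (A^T *m ys)) w.
Proof.
move=> gw; have [gx cy] := saddle_fin; have [_ /(_ w ys)/andP[_]] := saddle.
rewrite !Ftilde_fin// lee_fin !dotZl !dot_trmx; lra.
Qed.

Lemma saddle_dual i w (s : R) : conj_fun (f i) w = s%:E ->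
  w * (A *m xs) i 0 - s <=
  ys i 0 * (A *m xs) i 0 - fine (conj_fun (f i) (ys i 0)).
Proof.
move=> ws; have [gx cy] := saddle_fin.
(* Only coordinate [i] of [ys] moves, so all other terms cancel. *)
pose y : 'cV[R]_n := \col_j if j == i then w else ys j 0.
have yi : y i 0 = w by rewrite mxE eqxx.
have yj j : j != i -> y j 0 = ys j 0 by move=> /negPf ji; rewrite mxE ji.
have [_ /(_ xs y)/andP[+ _]] := saddle.
rewrite !Ftilde_fin//; last first.
  by move=> j; have [->|/yj->//] := eqVneq j i; rewrite yi ws.
rewrite lee_fin /dot (bigD1 i)//= [in leRHS](bigD1 i)//=.
rewrite [X in _ - _ * X <= _](bigD1 i)//= [X in _ <= _ - _ * X](bigD1 i)//=.
rewrite yi ws/=.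
under [X in _ * (_ + X) + _ - _ * _ <= _]eq_bigr => j /yj -> do [].
under [X in _ - _ * (_ + X) <= _]eq_bigr => j /yj -> do [].
move=> H; rewrite -(ler_pM2l n1_gt0); lra.
Qed.

End SaddlePoint.

(** * Averages over uniform index sequences *)

Section Expectation.
Variables (R : realType) (n : nat).
Hypothesis n_gt0 : (0 < n)%N.

Definition upd (s : nat -> nat) (t i : nat) : nat -> nat :=
  fun k => if k == t then i else s k.

Lemma idx_of_ltn T (w : {ffun 'I_T -> 'I_n}) t : (idx_of w t < n)%N.
Proof. by rewrite /idx_of; case: insubP => [u _ _|_]//=. Qed.

(** Tower property: by the bijection [h], a sample of length [T.+1] is a sample of length [T] with a
    fresh index in position [T]. *)
Lemma expect_idxS T (X : (nat -> nat) -> R) :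
  expect_idx T.+1 n X =
  expect_idx T n (fun s => n%:R^-1 * \sum_(i < n) X (upd s T i)).
Proof.
rewrite /expect_idx exprSr invfM -mulrA -mulr_sumr; congr (_ * (_ * _)).
rewrite pair_big/=.
pose h (p : {ffun 'I_T -> 'I_n} * 'I_n) : {ffun 'I_T.+1 -> 'I_n} :=
  [ffun k => if unlift ord_max k is Some j then p.1 j else p.2].
pose h' (w : {ffun 'I_T.+1 -> 'I_n}) : {ffun 'I_T -> 'I_n} * 'I_n :=
  ([ffun j => w (lift ord_max j)], w ord_max).
rewrite (reindex h)/=; last first.
  exists h' => [[w i] _|w _].
    congr pair; last by rewrite ffunE unlift_none.
    by apply/ffunP => j; rewrite !ffunE liftK.
  apply/ffunP => k; rewrite ffunE /=.
  by case: unliftP => [j ->|->]; rewrite ?ffunE.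
apply: eq_bigr => -[w i] _; congr (X _); apply: funext => t.
rewrite /upd /idx_of; case: insubP => [u _ ut|/= tT]/=.
  rewrite ffunE -ut; case: unliftP => [j ->|->]/=; last by rewrite eqxx.
  rewrite [bump _ _]/= /bump leqNgt ltn_ord add0n (ltn_eqF (ltn_ord j)).
  by rewrite (insubT (fun k => (k < T)%N) (ltn_ord j))/=; congr (nat_of_ord (w _)); exact: val_inj.
(* Past position [T] both sequences hold the default 0. *)
rewrite gtn_eqF; last by rewrite ltnNge -ltnS.
by rewrite insubF// ltnNge; apply/negbTE; rewrite negbK; move: tT; rewrite -leqNgt => /ltnW.
Qed.

Lemma expect_idx_le T (X Y : (nat -> nat) -> R) :
  (forall s, (forall t, (s t < n)%N) -> X s <= Y s) ->
  expect_idx T n X <= expect_idx T n Y.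
Proof.
move=> XY; rewrite ler_wpM2l ?invr_ge0 ?exprn_ge0//.
by apply: ler_sum => w _; apply: XY; exact: idx_of_ltn.
Qed.

(** Conditioning on the past means averaging over the index in position [t] with [s] fixed, so the
    supermartingale condition is pointwise in [s]. *)
Lemma expect_idx_supermartingale (Z : nat -> (nat -> nat) -> R) z T :
  (forall s, Z 0%N s = z) ->
  (forall t s, (forall k, (s k < n)%N) ->
    n%:R^-1 * \sum_(i < n) Z t.+1 (upd s t i) <= Z t s) ->
  expect_idx T n (Z T) <= z.
Proof.
move=> Z0 ZS; elim: T => [|T IH].
  rewrite /expect_idx expr0 invr1 mul1r (eq_bigr (fun=> z))//.
  by rewrite sumr_const card_ffun !card_ord expn0.
by rewrite expect_idxS; apply: le_trans IH; apply: expect_idx_le => s /ZS.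
Qed.

End Expectation.

(** * One deterministic step of dual averaging *)

Section DualAveragingStep.
Variables (R : realType) (d : nat).
Implicit Types (x a b s : 'cV[R]_d) (gx eta mu beta B e L : R).

Lemma sqn_shift x z v : sqn (x - (z - v)) = sqn (x - z) + 2 * dot v (x - z) + sqn (v : 'cV[R]_d).
Proof. by rewrite !sqnE !dotE (dotC z x) (dotC v x) (dotC z v); ring. Qed.

(* [x'] is the dual averaging iterate following [xt], [xb] the extrapolated
   point, [a] the slope used to compute [xb] and [a + b] the slope revealed
   afterwards. *)
Lemma dual_averaging_step x x' xb xt x0 xs s a b gx gx' gb gs eta mu beta B e L :
  0 < eta -> 0 <= beta -> beta <= eta * (1 + mu * B) -> 0 <= mu ->
  (B + beta) * gx' + sqn (x' - (x0 - (s + beta *: (a + b)))) / 2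
    + (1 + (B + beta) * mu) / 2 * sqn (x - x') <=
    (B + beta) * gx + sqn (x - (x0 - (s + beta *: (a + b)))) / 2 ->
  L + (1 + mu * B) / 2 * sqn (x' - xt) <=
    B * (gx' - gs) + dot s (x' - xs) + sqn (x' - x0) / 2 ->
  eta * gb + sqn (xb - (xt - eta *: a)) / 2
    + (1 + eta * mu) / 2 * sqn (x' - xb) <=
    eta * gx' + sqn (x' - (xt - eta *: a)) / 2 ->
  0 <= dot b (x' - xb) + (2 * eta)^-1 * sqn (x' - xb) + e ->
  L + beta * (gb - gs + dot (a + b) (xb - xs) - e)
    + (1 + mu * (B + beta)) / 2 * sqn (x - x') <=
  (B + beta) * (gx - gs) + dot (s + beta *: (a + b)) (x - xs) + sqn (x - x0) / 2.
Proof.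
move=> eta0 beta0 betaB mu0; rewrite !sqn_shift !dotE => H1 H2 H3 H4.
(* Scaling by [th] gives the proximal inequality of step [eta] the weight [beta]; [th <= 1 + mu * B]
   lets the invariant absorb [|x' - xt|^2]. *)
pose th := beta / eta.
have th0 : 0 <= th by rewrite divr_ge0// ltW.
have the : th * eta = beta by rewrite divfK ?gt_eqF.
have thB : th <= 1 + mu * B by rewrite ler_pdivrMr// mulrC.
have H3' : beta * gb + th * sqn (xb - xt) / 2 + beta * dot a xb
    + th / 2 * sqn (x' - xb) <= beta * gx' + th * sqn (x' - xt) / 2 + beta * dot a x'.
  have := ler_wpM2l th0 H3; rewrite -the.
  have := mulr_ge0 (mulr_ge0 (mulr_ge0 th0 (ltW eta0)) mu0) (sqn_ge0 (x' - xb)).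
  lra.
have H4' : 0 <= beta * (dot b x' - dot b xb) + th / 2 * sqn (x' - xb) + beta * e.
  have := mulr_ge0 beta0 H4.
  have -> : th / 2 * sqn (x' - xb) = beta * ((2 * eta)^-1 * sqn (x' - xb)).
    by rewrite /th; field; rewrite gt_eqF.
  lra.
have := mulr_ge0 th0 (sqn_ge0 (xb - xt)).
have := ler_wpM2r (sqn_ge0 (x' - xt)) thB.
lra.
Qed.

End DualAveragingStep.

(** * One dual step, averaged over the sampled coordinate *)

Section DualStep.
Variable R : realType.

Lemma young_ge0 (tau de q s : R) : 0 < tau -> tau * q ^+ 2 <= s ->
  0 <= de * q + s / 2 + (2 * tau)^-1 * de ^+ 2.
Proof.
move=> tau0 qs; have : 0 <= (2 * tau)^-1 * (de + tau * q) ^+ 2.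
  by rewrite mulr_ge0 ?sqr_ge0// invr_ge0 mulr_ge0 ?ltW.
have -> : (2 * tau)^-1 * (de + tau * q) ^+ 2 =
    (2 * tau)^-1 * de ^+ 2 + de * q + tau * q ^+ 2 / 2.
  by field; rewrite gt_eqF.
lra.
Qed.

(* Averaging the progress of a single random coordinate over all [n] coordinates.
   Per coordinate, with e = yh - ys, D = (y - ys)^2: the strong monotonicity of
   the dual prox leaves K e^2 - D / (2 tau), and [kap] is chosen so that the
   coefficient of D vanishes exactly. *)
Lemma coordinate_average_le (n : nat) (y yh ys r : 'I_n -> R)
  (gam tau beta beta' kap c0 : R) :
  (0 < n)%N -> 0 < tau -> 0 <= beta ->
  let K := gam + (2 * tau)^-1 in
  kap = K - gam / n%:R -> beta' * kap <= beta * K ->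
  (forall i, K * (yh i - ys i) ^+ 2 +
     (2 * tau)^-1 * ((yh i - y i) ^+ 2 - (y i - ys i) ^+ 2) <=
     r i * (yh i - ys i)) ->
  - (n%:R^-1 * \sum_i ys i * r i) <= c0 ->
  - (beta * kap * \sum_i (y i - ys i) ^+ 2) <=
  n%:R^-1 * \sum_(i < n)
    (beta * (c0 + n%:R^-1 * (\sum_j y j * r j) + (yh i - y i) * r i
             - (2 * tau)^-1 * (yh i - y i) ^+ 2)
     - beta' * kap * (\sum_j (y j - ys j) ^+ 2
             + (yh i - ys i) ^+ 2 - (y i - ys i) ^+ 2)).
Proof.
move=> n0 tau0 beta0 K kapE bK Hi c0E.
set N : R := n%:R; have N0 : 0 < N by rewrite ltr0n.
set P := \sum_j y j * r j; set S := \sum_j (y j - ys j) ^+ 2.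
(* The share of coordinate [i] once [P] and [S] are distributed over the coordinates and [c0] is
   replaced by its lower bound. *)
pose U i := beta * ((yh i - ys i) * r i - (2 * tau)^-1 * (yh i - y i) ^+ 2)
  - beta' * kap * ((yh i - ys i) ^+ 2 - (y i - ys i) ^+ 2 + N * (y i - ys i) ^+ 2).
have sumc (c : R) : \sum_(i < n) c = N * c.
  by rewrite sumr_const card_ord mulr_natl.
have UE : \sum_i U i <= \sum_(i < n)
    (beta * (c0 + N^-1 * P + (yh i - y i) * r i - (2 * tau)^-1 * (yh i - y i) ^+ 2)
     - beta' * kap * (S + (yh i - ys i) ^+ 2 - (y i - ys i) ^+ 2)).
  rewrite -subr_ge0 -sumrB.
  rewrite (eq_bigr (fun i => beta * (c0 + N^-1 * P) - beta' * kap * S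
     - beta * (y i * r i) + beta * (ys i * r i)
     + beta' * kap * N * (y i - ys i) ^+ 2)); last by move=> i _; rewrite /U; ring.
  rewrite big_split/= big_split/= sumrB sumc -!mulr_sumr -/P -/S.
  have -> : N * (beta * (c0 + N^-1 * P) - beta' * kap * S) - beta * P
      + beta * (\sum_i ys i * r i) + beta' * kap * N * S =
      beta * (N * (c0 + N^-1 * \sum_i ys i * r i)).
    by field; rewrite gt_eqF.
  apply: mulr_ge0 => //; apply: mulr_ge0; first exact: ltW.
  by rewrite -[_^-1 * _]opprK subr_ge0.
rewrite ler_pdivlMl//; apply: le_trans UE.
have -> : N * - (beta * kap * S) = \sum_i - (beta * kap) * (y i - ys i) ^+ 2 * N.
  by rewrite -mulr_suml -mulr_sumr -/S; ring.
apply: ler_sum => i _; rewrite /U.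
have := ler_wpM2l beta0 (Hi i).
have := ler_wpM2r (sqr_ge0 (yh i - ys i)) bK.
(* The part [(N - 1) * K] pays, through [bK], for the [N - 1] unsampled copies of D; [1 / (2 tau)]
   pays for the loss in [Hi]. *)
have Nkap : N * kap = (N - 1) * K + (2 * tau)^-1.
  by rewrite kapE /K mulrBr mulrCA divff ?gt_eqF// -/N; ring.
have D0 := sqr_ge0 (y i - ys i).
have N1 : 0 <= N - 1 by rewrite subr_ge0 ler1n.
have := ler_wpM2r D0 (ler_wpM2l N1 bK).
have -> : - (beta * kap) * (y i - ys i) ^+ 2 * N =
   - (beta * (y i - ys i) ^+ 2 * (N * kap)) by ring.
rewrite Nkap; lra.
Qed.

End DualStep.

(** * Potential argument for the SDAPD iterates *)

Section Analysis.
Variables (R : realType) (n d : nat) (A : 'M[R]_(n, d)).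
Variables (f : 'I_n -> R -> R) (g : 'cV[R]_d -> \bar R) (gam mu : R).
Variables (x0 xs : 'cV[R]_d) (y0 ys : 'cV[R]_n).
Hypotheses (n_gt0 : (0 < n)%N) (gam_gt0 : 0 < gam) (mu_gt0 : 0 < mu).
Hypothesis cf : forall i, convex_fun (f i).
Hypothesis sf : forall i, smooth_fun gam^-1 (f i).
Hypothesis g_NNy : forall x, g x != -oo%E.
Hypotheses (clg : closed_fun g) (scg : strongly_convex mu g).
Hypothesis saddle : is_saddle_point A f g xs ys.

Variables (eta tau xi : R).
Hypotheses (eta_gt0 : 0 < eta) (tau_gt0 : 0 < tau) (xi_gt1 : 1 < xi).
Hypothesis eta_tau : eta * tau * Rbar A ^+ 2 = 1.
Hypothesis xi_eta : xi - 1 <= mu * eta.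
Let K := gam + (2 * tau)^-1.
Let kap := K - gam / n%:R.
Hypothesis xi_kap : xi * kap <= K.
Variable beta : nat -> R.
Hypothesis betaE : forall t, beta t = eta * xi ^+ t.

Local Notation dom := (fun x => g x \is a fin_num).
Local Notation G := (fun x => fine (g x)).
Local Notation St := (sdapd A f g eta tau beta x0 y0).
Local Notation step := (sdapd_step A f g eta tau beta x0).
Implicit Types (st : sdapd_state R n d) (s : nat -> nat) (i j : 'I_n) (t : nat).

(** The sum stops before [t]: [B 0] is 0 and [Bsum beta t] is [B t.+1]. *)
Let B t := \sum_(k < t) beta k.

Lemma beta_gt0 t : 0 < beta t.
Proof. by rewrite betaE mulr_gt0// exprn_gt0// (lt_trans ltr01). Qed.

Lemma geometric_weights t : (xi - 1) * B t = eta * (xi ^+ t - 1).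
Proof.
rewrite subrX1 mulrCA; congr (_ * _).
by rewrite /B mulr_sumr; apply: eq_bigr => k _; rewrite betaE.
Qed.

(** By the geometric sum this reduces to [(xi - 1) * B t <= mu * eta * B t]: the weights grow no
    faster than the accumulated strong convexity. *)
Lemma beta_le t : beta t <= eta * (1 + mu * B t).
Proof.
have B0 : 0 <= B t by apply: sumr_ge0 => k _; exact/ltW/beta_gt0.
rewrite betaE ler_pM2l// -lerBlDl -(ler_pM2l eta_gt0) -geometric_weights.
by rewrite mulrCA mulrA ler_wpM2r.
Qed.

Definition st_next_xbar st :=
  prox_vec eta g (st_x st - (eta / n%:R) *: (A^T *m st_y st)).

(** Every coordinate as if it were sampled: this is determined by [st], and the random index only
    selects the coordinate to be written. *)
Definition st_next_y st j :=
  prox_scal tau (conj_fun (f j)) (st_y st j 0 + tau * (A *m st_next_xbar st) j 0).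

Lemma st_xbar_step t i st : st_xbar (step t i st) = st_next_xbar st.
Proof. by []. Qed.

Lemma st_y_step t i st : st_y (step t i st) - st_y st =
  (st_next_y st i - st_y st i 0) *: delta_mx i 0.
Proof.
apply/matrixP => j k; rewrite (ord1 k) [RHS]mxE [X in _ * X]mxE eqxx andbT.
rewrite [LHS]mxE [X in X + _]mxE [X in _ + X]mxE -val_eqE /st_next_y.
by case: eqVneq => [/val_inj->|_]; rewrite ?mulr1// mulr0 subrr.
Qed.

Lemma dot_delta i (c : R) v : dot (c *: delta_mx i 0) v = c * v i 0.
Proof.
rewrite dotZl /dot (bigD1 i)//= mxE !eqxx mul1r big1 ?addr0// => j /negPf ji.
by rewrite mxE ji mul0r.
Qed.

Lemma sqn_delta i (c : R) : sqn (c *: delta_mx i 0 : 'cV[R]_n) = c ^+ 2.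
Proof. by rewrite sqnE dot_delta !mxE !eqxx mulr1. Qed.

Lemma sdapdS s t : St s t.+1 = step t (s t) (St s t).
Proof. by []. Qed.

(** Adaptedness of the iterates; it makes [upd] at position [t] invisible up to time [t]. *)
Lemma sdapd_ext s s' t : (forall k, (k < t)%N -> s k = s' k) -> St s t = St s' t.
Proof.
elim: t => [//|t IH] ss'; rewrite !sdapdS ss'; last exact: ltnSn.
by rewrite IH// => k kt; apply: ss'; exact: ltnW.
Qed.

Lemma sdapd_upd s t i k : (k <= t)%N -> St (upd s t i) k = St s k.
Proof.
by move=> kt; apply: sdapd_ext => l lk; rewrite /upd ltn_eqF// (leq_trans lk).
Qed.

Lemma sdapd_updS s t i : St (upd s t i) t.+1 = step t i (St s t).
Proof. by rewrite sdapdS sdapd_upd// /upd eqxx. Qed.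

Definition gap st st' :=
  G (st_xbar st') - G xs
  + n%:R^-1 * dot (st_y st + n%:R *: (st_y st' - st_y st)) (A *m (st_xbar st' - xs))
  - (2 * tau)^-1 * sqn (st_y st' - st_y st).

Let nR_gt0 : 0 < n%:R :> R. Proof. by rewrite ltr0n. Qed.

(** The factor [n] in [ybar] cancels [1 / n], so the sampled coordinate enters with weight 1. *)
Lemma gap_step t i st (r := fun j => (A *m (st_next_xbar st - xs)) j 0) :
  gap st (step t i st) = G (st_next_xbar st) - G xs
    + n%:R^-1 * (\sum_j st_y st j 0 * r j)
    + (st_next_y st i - st_y st i 0) * r i
    - (2 * tau)^-1 * (st_next_y st i - st_y st i 0) ^+ 2.
Proof.
rewrite /gap st_y_step st_xbar_step sqn_delta dotDl dotZl dot_delta.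
by rewrite mulrDr mulKf ?gt_eqF// !addrA.
Qed.

Let p := n%:R^-1 *: (A^T *m ys).

(** Optimality of [xs] supplies the affine minorant that guarantees the existence of the proximal
    points of [g]. *)
Lemma saddle_minor w : dom w -> G xs + dot p xs + dot (- p) w <= G w.
Proof.
move=> dw; have := saddle_primal n_gt0 saddle dw.
by rewrite dotNl -/p lerBlDr.
Qed.

Lemma prox_stepP (c : R) u : 0 < c -> let v := prox_vec c g u in
  dom v /\ forall w, dom w ->
    prox_obj g c u v + (1 + c * mu) / 2 * sqn (w - v) <= prox_obj g c u w.
Proof.
move=> c0; have [dx _] := saddle_fin n_gt0 saddle.
exact: (prox_vecP (ltW mu_gt0) g_NNy clg scg u c0 dx saddle_minor).
Qed.

Lemma saddle_dual_derive1 i : ys i 0 = derive1 (f i) ((A *m xs) i 0).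
Proof.
have [_ cy] := saddle_fin n_gt0 saddle.
apply: (conj_fun_max_derive1 gam_gt0 (cf i) (sf i) (esym (fineK (cy i)))).
by move=> w r; exact: (saddle_dual n_gt0 saddle).
Qed.

Lemma average_progress t st :
  - (beta t * kap * sqn (st_y st - ys)) <=
  n%:R^-1 * \sum_(i < n)
    (beta t * (gap st (step t i st)
       - mu / 2 * sqn (st_xbar (step t i st) - xs))
     - beta t.+1 * kap * sqn (st_y (step t i st) - ys)).
Proof.
set xb := st_next_xbar st; pose r j := (A *m (xb - xs)) j 0.
have [dxs _] := saddle_fin n_gt0 saddle.
have [dxb _] : dom xb /\ _ := prox_stepP _ eta_gt0.
(* The term [mu / 2 |xb - xs|^2] is paid for by quadratic growth at [xs] of [g] tilted by [p]. *)
pose c0 := G xb - G xs - mu / 2 * sqn (xb - xs).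
have c0E : - (n%:R^-1 * \sum_i ys i 0 * r i) <= c0.
  have -> : n%:R^-1 * (\sum_i ys i 0 * r i) = dot p xb - dot p xs.
    transitivity (n%:R^-1 * dot ys (A *m (xb - xs))) => //.
    by rewrite -dot_trmx /p !dotZl dotDr dotNr mulrBr.
  have := strongly_convex_affine_minimizer g_NNy scg dxs
    (fun w => @saddle_primal _ _ _ _ _ _ _ _ n_gt0 saddle w) dxb.
  rewrite /c0 -/p; lra.
have Hi i : K * (st_next_y st i - ys i 0) ^+ 2 + (2 * tau)^-1 *
    ((st_next_y st i - st_y st i 0) ^+ 2 - (st_y st i 0 - ys i 0) ^+ 2) <=
    r i * (st_next_y st i - ys i 0).
  have -> : r i = (A *m xb) i 0 - (A *m xs) i 0.
    by rewrite /r mulmxBr mxE [X in _ + X]mxE.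
  rewrite !saddle_dual_derive1.
  exact: (prox_scal_conj_fun_ineq _ gam_gt0 tau_gt0 (cf i) (sf i) erefl).
have bK : beta t.+1 * kap <= beta t * K.
  by rewrite betaE exprSr mulrA -betaE -mulrA ler_wpM2l// ltW// beta_gt0.
have := coordinate_average_le n_gt0 tau_gt0 (ltW (beta_gt0 t)) erefl bK Hi c0E.
have sqnYE : \sum_j (st_y st j 0 - ys j 0) ^+ 2 = sqn (st_y st - ys).
  by apply: eq_bigr => j _; rewrite !mxE.
rewrite sqnYE => /le_trans; apply; rewrite le_eqVlt; apply/orP; left; apply/eqP.
congr (_ * _); apply: eq_bigr => i _; rewrite gap_step st_xbar_step -/xb.
congr (_ * _ - _ * _); first by rewrite /c0 /r; ring.
have -> : st_y (step t i st) - ys =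
    (st_y (step t i st) - st_y st) + (st_y st - ys) by rewrite addrA subrK.
rewrite st_y_step [in RHS]sqnD sqn_delta dot_delta.
have -> : (st_y st - ys) i 0 = st_y st i 0 - ys i 0 by rewrite !mxE.
ring.
Qed.

Lemma row_norm_dot_le i (h : 'cV[R]_d) :
  (A *m h) i 0 ^+ 2 <= Rbar A ^+ 2 * sqn h.
Proof.
have -> : (A *m h) i 0 = dot (row i A)^T h.
  by rewrite mxE; apply: eq_bigr => j _; rewrite !mxE.
apply: le_trans (dot_sqr_le _ _) _; apply: ler_wpM2r; first exact: sqn_ge0.
have -> : sqn (row i A)^T = row_norm A i ^+ 2.
  rewrite /row_norm sqr_sqrtr; last by apply: sumr_ge0 => j _; exact: sqr_ge0.
  by apply: eq_bigr => j _; rewrite !mxE.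
rewrite lerXn2r ?nnegrE ?sqrtr_ge0//; last exact: le_bigmax.
by apply: le_trans (le_bigmax _ _ i); exact: sqrtr_ge0.
Qed.

(** The dual change has a single coordinate, so only one row of [A] acts and [Rbar A] suffices
    instead of an operator norm. *)
Lemma coupling_ge0 i (c : R) (h : 'cV[R]_d) :
  0 <= dot (A^T *m (c *: delta_mx i 0)) h + (2 * eta)^-1 * sqn h
    + (2 * tau)^-1 * sqn (c *: delta_mx i 0 : 'cV[R]_n).
Proof.
rewrite dot_trmx sqn_delta dot_delta.
have -> : (2 * eta)^-1 * sqn h = (eta^-1 * sqn h) / 2 by field; rewrite gt_eqF.
apply: young_ge0 tau_gt0 _.
have -> : eta^-1 * sqn h = tau * (Rbar A ^+ 2 * sqn h).
  by rewrite -[LHS]mul1r -eta_tau; field; rewrite gt_eqF.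
by rewrite ler_pM2l//; exact: row_norm_dot_le.
Qed.

(** Stated for every [x] of the domain, because the induction step applies it at the next iterate;
    [x = xs] is set only at the end. *)
Definition dual_avg_inv st t (L : R) := forall x, dom x ->
  L + (1 + mu * B t) / 2 * sqn (x - st_x st) <=
  B t * (G x - G xs) + dot (st_s st) (x - xs) + sqn (x - x0) / 2.

Lemma dual_avg_inv_step t i st L : dual_avg_inv st t L ->
  dual_avg_inv (step t i st) t.+1 (L + beta t * gap st (step t i st)).
Proof.
move=> inv x dx.
set st' := step t i st; set xb := st_next_xbar st.
pose dy := st_y st' - st_y st.
pose a := n%:R^-1 *: (A^T *m st_y st); pose b := A^T *m dy.
have BS : B t.+1 = B t + beta t by rewrite /B big_ord_recr.
have B0 : 0 < B t.+1.
  have B0 : 0 <= B t by apply: sumr_ge0 => k _; exact/ltW/beta_gt0.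
  by rewrite BS ltr_wpDl// beta_gt0.
(* The revealed slope [A^T ybar / n] is the slope [a] used for [xb] plus the correction [b]. *)
have ab : (beta t / n%:R) *: (A^T *m (st_y st + n%:R *: dy)) = beta t *: (a + b).
  rewrite mulmxDr -scalemxAr scalerDr scalerA divfK ?gt_eqF// [in RHS]scalerDr.
  by rewrite scalerA.
have sE : st_s st' = st_s st + beta t *: (a + b) by rewrite -ab.
have xE : st_x st' = prox_vec (B t.+1) g (x0 - (st_s st + beta t *: (a + b))).
  by rewrite -ab.
have [dx' H1] := prox_stepP (x0 - (st_s st + beta t *: (a + b))) B0.
rewrite -xE in dx' H1.
have [_ H3] := prox_stepP (st_x st - (eta / n%:R) *: (A^T *m st_y st)) eta_gt0.
have := H3 _ dx'; rewrite -/(st_next_xbar st) -/xb -scalerA -/a => {}H3.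
have gapE : gap st st' = G xb - G xs + dot (a + b) (xb - xs)
    - (2 * tau)^-1 * sqn dy.
  have -> : dot (a + b) (xb - xs) =
      n%:R^-1 * dot (st_y st) (A *m (xb - xs)) + dot dy (A *m (xb - xs)).
    by rewrite dotDl /a /b dotZl !dot_trmx.
  by rewrite /gap st_xbar_step -/xb -/dy dotDl dotZl mulrDr mulKf// gt_eqF.
rewrite gapE sE BS; rewrite BS in H1.
apply: (dual_averaging_step (gx' := G (st_x st')) eta_gt0 (ltW (beta_gt0 t))
  (beta_le t) (ltW mu_gt0) (H1 _ dx) (inv _ dx') H3).
rewrite /b /dy st_y_step; exact: coupling_ge0.
Qed.

Let Gap s T := \sum_(k < T) beta k * gap (St s k) (St s k.+1).

Lemma Gap_le s T : (forall t, (s t < n)%N) -> Gap s T <= sqn (xs - x0) / 2.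
Proof.
move=> sn; have [dxs _] := saddle_fin n_gt0 saddle.
have : dual_avg_inv (St s T) T (Gap s T).
  elim: T => [|T IH].
    by move=> x dx; rewrite /B /Gap !big_ord0/= dot0l; lra.
  rewrite /Gap big_ord_recr/= -/(Gap s T).
  exact: (@dual_avg_inv_step T (Ordinal (sn T))).
move=> /(_ _ dxs); rewrite !subrr dot0r mulr0 !add0r; apply: le_trans.
have B0 : 0 <= B T by apply: sumr_ge0 => k _; exact/ltW/beta_gt0.
rewrite lerDl mulr_ge0 ?sqn_ge0// divr_ge0// addr_ge0// mulr_ge0//; exact: ltW.
Qed.

Definition progress s k := beta k * (gap (St s k) (St s k.+1)
  - mu / 2 * sqn (st_xbar (St s k.+1) - xs)).

Definition dual_dist s k := sqn (st_y (St s k) - ys).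

(** By [Gap_le] the constant makes this dominate [mu / 2] times the weighted sum of [|xbar - xs|^2],
    while its mean does not increase. *)
Definition potential t s := sqn (xs - x0) / 2 - \sum_(k < t) progress s k
  + beta t * kap * dual_dist s t.

Lemma progress_upd s t i k : (k < t)%N -> progress (upd s t i) k = progress s k.
Proof.
by move=> kt; rewrite /progress (sdapd_upd _ _ kt) (sdapd_upd _ _ (ltnW kt)).
Qed.

Lemma potentialS_upd s t i : potential t.+1 (upd s t i) =
  sqn (xs - x0) / 2 - \sum_(k < t) progress s k
  - (beta t * (gap (St s t) (step t i (St s t))
       - mu / 2 * sqn (st_xbar (step t i (St s t)) - xs))
     - beta t.+1 * kap * sqn (st_y (step t i (St s t)) - ys)).
Proof.
have -> : sqn (st_y (step t i (St s t)) - ys) = dual_dist (upd s t i) t.+1.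
  by rewrite /dual_dist sdapd_updS.
have -> : beta t * (gap (St s t) (step t i (St s t))
    - mu / 2 * sqn (st_xbar (step t i (St s t)) - xs)) = progress (upd s t i) t.
  by rewrite /progress sdapd_updS sdapd_upd.
have E : \sum_(k < t) progress (upd s t i) (widen_ord (leqnSn t) k) =
    \sum_(k < t) progress s k.
  apply: eq_bigr => k _; exact: (progress_upd s i (ltn_ord k)).
have ES : \sum_(k < t.+1) progress (upd s t i) k =
    \sum_(k < t) progress s k + progress (upd s t i) t.
  exact: etrans (big_ord_recr _ _) (congr2 +%R E erefl).
rewrite /potential ES.
move: (progress _ _) (dual_dist _ _) (\sum_(k < t) _) => u v w; ring.
Qed.

Lemma potential_supermartingale t s :
  n%:R^-1 * \sum_(i < n) potential t.+1 (upd s t i) <= potential t s.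
Proof.
under eq_bigr do rewrite potentialS_upd.
rewrite sumrB sumr_const card_ord mulrBr mulrnAr -mulrnAl -[_ *+ n]mulr_natr.
rewrite mulVf ?gt_eqF// mul1r.
by rewrite lerD2l lerNl; exact: average_progress.
Qed.

Lemma kap_ge0 : 0 <= kap.
Proof.
have gn : gam / n%:R <= gam.
  by rewrite ler_pdivrMr// ler_peMr ?(ltW gam_gt0)// ler1n.
have : 0 < (2 * tau)^-1 by rewrite invr_gt0 mulr_gt0.
rewrite /kap /K; lra.
Qed.

Lemma sdapd_xhat_sqn_le s T : (0 < T)%N -> (forall t, (s t < n)%N) ->
  sqn (sdapd_xhat A f g eta tau beta x0 y0 s T - xs) <=
  2 / (mu * B T) * potential T s.
Proof.
move=> T0 sn.
have BT : 0 < B T.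
  by case: T T0 => // T _; rewrite /B big_ord_recr/= ltr_wpDl ?beta_gt0//
    sumr_ge0// => k _; exact/ltW/beta_gt0.
have BsumE : Bsum beta T.-1 = B T by rewrite /Bsum prednK.
rewrite /sdapd_xhat BsumE.
apply: le_trans (sqn_wmean (fun t => st_xbar (St s t.+1)) xs
  (fun t => ltW (beta_gt0 t)) BT) _.
pose E := \sum_(t < T) beta t * sqn (st_xbar (St s t.+1) - xs); rewrite -/E.
have -> : 2 / (mu * B T) * potential T s = (B T)^-1 * (2 / mu * potential T s).
  by field; rewrite !gt_eqF.
rewrite ler_wpM2l ?invr_ge0 ?(ltW BT)// mulrAC ler_pdivlMr//.
have EE : \sum_(k < T) progress s k = Gap s T - mu / 2 * E.
  by rewrite mulr_sumr -sumrB; apply: eq_bigr => k _; rewrite /progress mulrBr [in RHS]mulrCA.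
rewrite /potential EE; have := Gap_le T sn.
have D0 : 0 <= dual_dist s T by exact: sqn_ge0.
have := mulr_ge0 (mulr_ge0 (ltW (beta_gt0 T)) kap_ge0) D0.
lra.
Qed.

Lemma expect_sdapd_le T : (0 < T)%N ->
  expect_idx T n (fun s =>
    sqn (sdapd_xhat A f g eta tau beta x0 y0 s T - xs)) <=
  2 * (sqn (xs - x0) / 2 + eta * kap * sqn (y0 - ys)) * (xi - 1) / (mu * eta)
    / (xi ^+ T - 1).
Proof.
move=> T0; have xiT : 0 < xi ^+ T - 1 by rewrite subr_gt0 exprn_egt1// -lt0n.
have xi1 : 0 < xi - 1 by rewrite subr_gt0.
have BE : B T = eta * (xi ^+ T - 1) / (xi - 1).
  by rewrite -geometric_weights mulrAC divff ?gt_eqF// mul1r.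
have BT : 0 < B T by rewrite BE divr_gt0// mulr_gt0.
set c := 2 / (mu * B T).
have c0 : 0 <= c by rewrite divr_ge0// mulr_ge0 ?ltW.
apply: (@le_trans _ _ (expect_idx T n (fun s => c * potential T s))).
  by apply: expect_idx_le => // s sn; exact: sdapd_xhat_sqn_le.
(* With [T] fixed, [c] is constant, so the scaled potential is still a supermartingale; its value at
   time 0 is deterministic. *)
apply: (@expect_idx_supermartingale _ _ n_gt0 (fun t s => c * potential t s)).
  move=> s; have dE : dual_dist s 0 = sqn (y0 - ys) by [].
  rewrite /potential big_ord0 dE betaE expr0 mulr1 subr0 /c BE.
  by field; rewrite !gt_eqF.
move=> t s _; rewrite -mulr_sumr mulrCA ler_wpM2l//.
exact: potential_supermartingale.
Qed.

End Analysis.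

(** * Arithmetic of the step sizes and the final bound *)

Lemma sdapd_parameters (R : realType) (N gam mu r : R) :
  1 <= N -> 0 < gam -> 0 < mu -> 0 < r ->
  let eta := r^-1 * Num.sqrt (gam / (N * mu)) in
  let tau := r^-1 * Num.sqrt (N * mu / gam) in
  let xi := 1 + (N + r * Num.sqrt (N / (mu * gam)))^-1 in
  let K := gam + (2 * tau)^-1 in
  [/\ 0 < eta, 0 < tau, eta * tau * r ^+ 2 = 1,
      xi - 1 <= mu * eta /\ 1 < xi & xi * (K - gam / N) <= K].
Proof.
move=> N1 gam0 mu0 r0 eta tau xi K.
have N0 : 0 < N by exact: lt_le_trans N1.
(* In terms of [h] all is rational: [eta = h / r], [tau = 1 / (r h)], [gam = h^2 N mu]. *)
pose h := Num.sqrt (gam / (N * mu)).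
have h0 : 0 < h by rewrite sqrtr_gt0 divr_gt0// mulr_gt0.
have h2 : h ^+ 2 = gam / (N * mu) by rewrite sqr_sqrtr// divr_ge0 ?mulr_ge0 ?ltW.
have hV : Num.sqrt (N * mu / gam) = h^-1.
  by rewrite /h -sqrtrV ?divr_ge0 ?mulr_ge0 ?ltW// invf_div.
have gamE : gam = h ^+ 2 * (N * mu) by rewrite h2 divfK// gt_eqF// mulr_gt0.
have hM : Num.sqrt (N / (mu * gam)) = (mu * h)^-1.
  have -> : N / (mu * gam) = ((mu * h)^-1) ^+ 2.
    by rewrite gamE; field; rewrite !gt_eqF.
  by rewrite sqrtr_sqr gtr0_norm// invr_gt0 mulr_gt0.
have eta0 : 0 < eta by rewrite /eta -/h mulr_gt0// invr_gt0.
have tau0 : 0 < tau by rewrite /tau hV mulr_gt0 ?invr_gt0.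
(* One quantity in two forms: [1 / (mu eta)] serves the primal condition on [xi], [N / (tau gam)]
   the dual one. *)
have rE : r * Num.sqrt (N / (mu * gam)) = (mu * eta)^-1.
  by rewrite hM /eta -/h; field; rewrite !gt_eqF.
have rE' : r * Num.sqrt (N / (mu * gam)) = N / (tau * gam).
  by rewrite hM /tau hV gamE; field; rewrite !gt_eqF.
have me0 : 0 < (mu * eta)^-1 by rewrite invr_gt0 mulr_gt0.
have rho0 : 0 < (N + (mu * eta)^-1)^-1 by rewrite invr_gt0 addr_gt0.
split=> //.
- by rewrite /eta /tau -/h hV; field; rewrite !gt_eqF.
- rewrite /xi rE; split; last by rewrite ltrDl.
  rewrite addrAC subrr add0r -[leRHS]invrK lef_pV2 ?posrE ?addr_gt0//.
  by rewrite lerDr ltW.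
rewrite /xi rE' /K.
have tg : 0 < tau * gam by rewrite mulr_gt0.
have t1 : 0 < tau * gam + 1 by rewrite addr_gt0.
rewrite -subr_ge0.
have -> : gam + (2 * tau)^-1 - (1 + (N + N / (tau * gam))^-1) *
    (gam + (2 * tau)^-1 - gam / N) =
    gam / (2 * N * (tau * gam + 1)) + tau * gam ^+ 2 / (N ^+ 2 * (tau * gam + 1)).
  by field; rewrite !gt_eqF// addr_gt0// mulr_gt0.
by apply/ltW/addr_gt0; apply: divr_gt0 => //; do ?apply: mulr_gt0 => //;
  exact: exprn_gt0.
Qed.

Theorem theorem3p5 (R : realType) (n d : nat) (A : 'M[R]_(n, d))
  (f : 'I_n -> R -> R) (g : 'cV[R]_d -> \bar R) (gamma mu : R)
  (x0 : 'cV[R]_d) (y0 : 'cV[R]_n) (xs : 'cV[R]_d) (ys : 'cV[R]_n) :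
  (0 < n)%N -> 0 < gamma -> 0 < mu -> 0 < Rbar A ->
  (forall i, convex_fun (f i)) -> (forall i, smooth_fun gamma^-1 (f i)) ->
  (forall x, g x != -oo%E) -> closed_fun g -> strongly_convex mu g ->
  is_saddle_point A f g xs ys ->
  let Rb := Rbar A in
  let eta := Rb^-1 * Num.sqrt (gamma / (n%:R * mu)) in
  let tau := Rb^-1 * Num.sqrt (n%:R * mu / gamma) in
  let xi := 1 + (n%:R + Rb * Num.sqrt (n%:R / (mu * gamma)))^-1 in
  let beta := fun t : nat => Rb^-1 * Num.sqrt (gamma / (n%:R * mu)) * xi ^+ t in
  exists Delta0 : R, 0 <= Delta0 /\
    forall T : nat, (1 <= T)%N ->
      expect_idx T n (fun idx =>
        sqn (sdapd_xhat A f g eta tau beta x0 y0 idx T - xs))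
      <= Delta0 / (xi ^+ T - 1).
Proof.
move=> n0 gam0 mu0 Rb0 cf sf g_NNy clg scg saddle Rb eta tau xi beta.
have N1 : 1 <= n%:R :> R by rewrite ler1n.
have [eta0 tau0 et [xm xi1] xk] := sdapd_parameters N1 gam0 mu0 Rb0.
pose kap := gamma + (2 * tau)^-1 - gamma / n%:R.
(* The initial potential times [2 / (mu B_T)], with [1 / (xi^T - 1)] split off. *)
exists (2 * (sqn (xs - x0) / 2 + eta * kap * sqn (y0 - ys)) * (xi - 1) / (mu * eta)).
split; last first.
  move=> T T0; exact: (expect_sdapd_le x0 y0 n0 gam0 mu0 cf sf g_NNy clg scg
    saddle eta0 tau0 xi1 et xm xk (fun=> erefl) T0).
have k0 : 0 <= kap := kap_ge0 n0 gam0 tau0.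
have C0 : 0 <= sqn (xs - x0) / 2 + eta * kap * sqn (y0 - ys).
  by rewrite addr_ge0 ?divr_ge0 ?sqn_ge0// mulr_ge0 ?sqn_ge0// mulr_ge0// ltW.
apply: divr_ge0; last exact/ltW/mulr_gt0.
by apply: mulr_ge0; [exact: mulr_ge0|rewrite subr_ge0 ltW].
Qed.
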